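(* Let $F\subset\mathbb{R}^2$ be compact, convex, with nonempty interior, let $X_m$ be a finite $\eta_m$-net of $X=F\times O(2)$ (with respect to the metric $d_X$), and let $D_m$ be the optimal value of the sampled minimum-diameter traveling salesman problem with neighborhoods associated with $X_m$. Then $$D_m\le D(F)\le D_m+2\eta_m.$$ In particular, $D_m\to D(F)$ whenever $\eta_m\to 0$. If the samples are nested ($X_m\subset X_{m+1}$ for all $m$), then $D_m$ is nondecreasing in $m$.
   Context: $O(2)$ is the full orthogonal group of $\mathbb{R}^2$, $\|\cdot\|$ the Euclidean norm, $\|\cdot\|_{\mathrm{op}}$ the operator norm. A closed path is a continuous map $\gamma:[0,1]\to\mathbb{R}^2$ with $\gamma(0)=\gamma(1)$; its trace is $\Gamma=\gamma([0,1])$ and $\operatorname{diam}\gamma:=\operatorname{diam}\Gamma$. It is a diameter-escape path for $F$ if $a+Q\Gamma\not\subset\operatorname{int}F$ for every $a\in\mathbb{R}^2$, $Q\in O(2)$. The critical escape diameter is $D(F):=\inf\{\operatorname{diam}\gamma:\gamma\text{ is a closed diameter-escape path for }F\}$. On $X=F\times O(2)$ use the metric $d_X((x,Q),(y,P)):=\|x-y\|+\operatorname{diam}(F)\,\|Q-P\|_{\mathrm{op}}$. A finite $\eta$-net is a finite subset of $X$ such that every point of $X$ is within $d_X$-distance at most $\eta$ of it. For $\xi=(x,Q)\in X$ put $\mathcal{N}_\xi:=Q^{T}(\partial F-x)$. For each $m$ let $X_m=\{\xi_1^m,\dots,\xi_{M_m}^m\}$ and $\mathcal{N}_j^m:=\mathcal{N}_{\xi_j^m}$.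 For points $p_j\in\mathcal{N}_j^m$ ($1\le j\le M_m$) and a permutation $\pi$ of $\{1,\dots,M_m\}$, let $\Gamma_{\pi,p}$ be the closed polygonal tour $[0,p_{\pi(1)}]\cup\bigcup_{k=1}^{M_m-1}[p_{\pi(k)},p_{\pi(k+1)}]\cup[p_{\pi(M_m)},0]$. Then $$D_m:=\min_{\pi,\ p_j\in\mathcal{N}_j^m}\operatorname{diam}\Gamma_{\pi,p}=\min_{p_j\in\mathcal{N}_j^m}\ \max_{0\le r<s\le M_m}\|p_r-p_s\|,\qquad p_0:=0.$$ *)

(* Defs.v *)
(* Written over MathComp-Analysis. Points of the plane are column vectors 'cV[R]_2. Their
   library topology is the Euclidean one, but the library norm `|x| of a matrix
   is the maximum of the absolute values of its entries. *)
From mathcomp Require Export all_boot all_order all_fingroup all_algebra.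
From mathcomp Require Export finmap.
From mathcomp Require Export all_classical all_reals all_analysis.
Export Order.TTheory GRing.Theory Num.Theory.
Export numFieldNormedType.Exports.

#[export] Set Implicit Arguments.
#[export] Unset Strict Implicit.
#[export] Unset Printing Implicit Defensive.

Global Open Scope classical_set_scope.
Global Open Scope ring_scope.

Section Plane.
Context {R : realType}.
Implicit Types (x y z a : 'cV[R]_2) (A F : set 'cV[R]_2).

Definition enorm x : R := Num.sqrt (\sum_i x i 0 ^+ 2).

Definition opnorm (M : 'M[R]_2) : R :=
  sup [set enorm (M *m x) | x in [set x | enorm x <= 1]].

Definition O2 : set 'M[R]_2 := [set Q | Q^T *m Q = 1%:M].

Definition diam A : R := sup [set enorm (xy.1 - xy.2) | xy in A `*` A].

Definition boundary F : set 'cV[R]_2 := closure F `\` F°.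

Definition segment x y : set 'cV[R]_2 :=
  [set (1 - t) *: x + t *: y | t in `[0, 1]].

(* The least element of E; it is 0 when E has none, so statements about it also
   carry the existence of that least element. *)
Definition minimum (E : set R) : R := xget 0 (E `&` lbound E).

(* A path is represented by a total function of which only the values on
   `[0, 1] matter. *)
Definition closed_path (g : R -> 'cV[R]_2) : Prop :=
  {within `[0, 1], continuous g} /\ g 0 = g 1.

Definition trace (g : R -> 'cV[R]_2) : set 'cV[R]_2 := g @` `[0, 1].

Definition diameter_escape F (g : R -> 'cV[R]_2) : Prop :=
  forall a (Q : 'M[R]_2), O2 Q ->
    ~ ([set a + Q *m x | x in trace g] `<=` F°).

(* The real-valued inf is 0 by convention on the empty set; for bounded F the set
   below is nonempty (large circles escape), and it is bounded below by 0. *)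
Definition critical_escape_diameter F : R :=
  inf [set diam (trace g) | g in [set g | closed_path g /\ diameter_escape F g]].

Definition config : choiceType := ('cV[R]_2 * 'M[R]_2)%type.

Definition configs F : set config := F `*` O2.

Definition config_dist F (xi zeta : config) : R :=
  enorm (xi.1 - zeta.1) + diam F * opnorm (xi.2 - zeta.2).

Definition is_net F (eta : R) (X : {fset config}) : Prop :=
  [set` X] `<=` configs F /\
  forall xi, configs F xi -> exists2 zeta, zeta \in X & config_dist F xi zeta <= eta.

Definition neighborhood F (xi : config) : set 'cV[R]_2 :=
  [set xi.2^T *m (b - xi.1) | b in boundary F].

Fixpoint polyline x (s : seq 'cV[R]_2) : set 'cV[R]_2 :=
  if s is y :: s' then segment x y `|` polyline y s' else [set x].

(* The closed polygon through 0, p (pi 0), ..., p (pi (M - 1)) and back to 0. *)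
Definition tour (M : nat) (pi : 'S_M) (p : 'I_M -> 'cV[R]_2) : set 'cV[R]_2 :=
  polyline 0 (rcons [seq p (pi k) | k <- enum 'I_M] 0).

(* The enumeration of X that numbers its points is the one carried by the
   finite set itself. *)
Definition sample (X : {fset config}) : 'I_(size X) -> config :=
  tnth (in_tuple X).

Definition sampled_diameter F (X : {fset config}) : R :=
  minimum [set d | exists (pi : 'S_(size X)) (p : 'I_(size X) -> 'cV[R]_2),
    (forall j, neighborhood F (sample j) (p j)) /\ d = diam (tour pi p)].

End Plane.

Arguments config R : clear implicits.

(* Main.v *)
Require Import Defs.
From mathcomp Require Import ring lra.

(** Both bounds are obtained by turning one kind of object into the other, an
    escape path into a choice of one point per neighborhood and back, while
    controlling the diameter. By convexity of the Euclidean distance, the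
    diameter of a polygonal tour is that of its vertex set, 0 included, so the
    order of the visits is irrelevant and the sampled problem only asks for
    points p_j in the neighborhoods N_j minimizing the diameter of
    {0, p_1, ..., p_M} (diam_tour). The N_j are compact, so the minimum is
    attained (sampled_diameterP), and any set that contains 0 and meets every
    N_j has at least the minimal diameter (sampled_diameter_le).

    Lower bound. Translate an escape path so that it starts at 0. For a sample
    (x, Q), its image under z |-> x + Q z is connected, starts at x in F and is
    not contained in the interior of F, so it meets the boundary of F
    (boundary_hit). This says that the translated trace meets N_(x, Q), so its
    diameter is at least the sampled one. This also shows that all
    neighborhoods are nonempty, since escape paths exist.

    Upper bound. Let p be an optimal choice of points and r the radius of the
    net. A closed path whose trace contains 0 and the circle of radius r about
    each p_j, and stays within r of the segments [0, p_j], has diameter at most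
    the sampled one plus 2 r (diam_bouquet). It is an escape path: if it were
    moved into the interior of F by (a, Q), then a would lie in F, the
    interior, being convex, would contain the moved discs of radius r about
    the p_j (convex_ball_of_circle), but for a sample (x, P) within r of
    (a, Q) the boundary point x + P p_j lies in the disc about a + Q p_j
    (bouquet_escape).

    Convergence follows by squeezing. For nested samples, the optimal points of
    the larger sample meet all the neighborhoods of the smaller one. *)

Section Plane.
Context {R : realType}.
Implicit Types (x y z a : 'cV[R]_2) (A F : set 'cV[R]_2) (Q P : 'M[R]_2).

(** * Euclidean and operator norms in the plane *)

Lemma enormE x : enorm x = Num.sqrt (x 0 0 ^+ 2 + x 1 0 ^+ 2).
Proof.
rewrite /enorm big_ord_recl big_ord1.
by congr (Num.sqrt (_ + x _ _ ^+ 2)); apply/val_inj.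
Qed.

Lemma enorm_ge0 x : 0 <= enorm x.
Proof. exact: sqrtr_ge0. Qed.

Lemma enorm_sqr x : enorm x ^+ 2 = x 0 0 ^+ 2 + x 1 0 ^+ 2.
Proof. by rewrite enormE sqr_sqrtr// addr_ge0// sqr_ge0. Qed.

Lemma enorm0 : enorm (0 : 'cV[R]_2) = 0.
Proof. by rewrite enormE !mxE expr0n/= addr0 sqrtr0. Qed.

Lemma cV2_ext x y : x 0 0 = y 0 0 -> x 1 0 = y 1 0 -> x = y.
Proof.
move=> xy0 xy1; apply/matrixP => i j; rewrite (ord1 j).
by case: (unliftP 0 i) => [k|] -> //; rewrite (ord1 k) (_ : lift _ _ = 1)//; apply/val_inj.
Qed.

Lemma enorm_eq0 x : enorm x = 0 -> x = 0.
Proof.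
move=> x0; have := enorm_sqr x; rewrite x0 expr0n/= => /esym/eqP.
rewrite paddr_eq0 ?sqr_ge0// !sqrf_eq0 => /andP[/eqP x00 /eqP x10].
by apply: cV2_ext; rewrite mxE.
Qed.

Lemma enormZ (c : R) x : enorm (c *: x) = `|c| * enorm x.
Proof. by rewrite !enormE !mxE !exprMn -mulrDr sqrtrM ?sqr_ge0// sqrtr_sqr. Qed.

Lemma enormN x : enorm (- x) = enorm x.
Proof. by rewrite -scaleN1r enormZ normrN1 mul1r. Qed.

Lemma enormBC x y : enorm (x - y) = enorm (y - x).
Proof. by rewrite -enormN opprB. Qed.

Lemma enormD x y : enorm (x + y) <= enorm x + enorm y.
Proof.
have [x0 y0] := (enorm_ge0 x, enorm_ge0 y).
rewrite -ler_sqr ?nnegrE ?enorm_ge0 ?addr_ge0// sqrrD !enorm_sqr !mxE.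
suff : x 0 0 * y 0 0 + x 1 0 * y 1 0 <= enorm x * enorm y by nra.
rewrite (le_trans (ler_norm _))// -ler_sqr ?nnegrE ?mulr_ge0// exprMn !enorm_sqr.
rewrite real_normK ?num_real//.
suff : 0 <= (x 0 0 * y 1 0 - x 1 0 * y 0 0) ^+ 2 by nra.
exact: sqr_ge0.
Qed.

Lemma enorm_trmulmx x : enorm x ^+ 2 = (x^T *m x) 0 0.
Proof.
rewrite enorm_sqr mxE big_ord_recl big_ord1 !mxE !expr2.
by do ?congr (_ + _ * _); congr (x _ _); apply/val_inj.
Qed.

Lemma enorm_O2 Q x : O2 Q -> enorm (Q *m x) = enorm x.
Proof.
move=> QO; apply/eqP; rewrite -(@eqrXn2 _ 2) ?enorm_ge0//; apply/eqP.
by rewrite !enorm_trmulmx trmx_mul -mulmxA (mulmxA Q^T) QO mul1mx.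
Qed.

Lemma O2_mulmxV Q : O2 Q -> Q *m Q^T = 1%:M.
Proof. exact: mulmx1C. Qed.

Lemma O2_tr Q : O2 Q -> O2 Q^T.
Proof. by rewrite /O2/= trmxK; exact: mulmx1C. Qed.

Lemma sup_ge0 (E : set R) : (forall r, E r -> 0 <= r) -> 0 <= sup E.
Proof.
move=> E0; have [supE|/sup_out->//] := pselect (has_sup E).
have [r Er] := supE.1; apply: le_trans (E0 _ Er) _.
exact: ub_le_sup supE.2 _ Er.
Qed.

Lemma opnorm_ge0 (M : 'M[R]_2) : 0 <= opnorm M.
Proof. by apply: sup_ge0 => _ [x _ <-]; exact: enorm_ge0. Qed.

(** The bound by c serves only to make the set defining the operator norm
    bounded, since the supremum of an unbounded set is 0 by convention. *)
Lemma le_opnorm (M : 'M[R]_2) (c : R) x : (forall y, enorm (M *m y) <= c * enorm y) ->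
  enorm (M *m x) <= opnorm M * enorm x.
Proof.
move=> Mc; have [x0|x0] := eqVneq (enorm x) 0.
  by rewrite (enorm_eq0 x0) mulmx0 enorm0 mulr0.
have xgt0 : 0 < enorm x by rewrite lt_neqAle eq_sym x0 enorm_ge0.
have [u ux u1] : exists2 u, x = enorm x *: u & enorm u = 1.
  exists ((enorm x)^-1 *: x); first by rewrite scalerA divff// scale1r.
  by rewrite enormZ gtr0_norm ?invr_gt0// mulVf.
rewrite {1}ux -scalemxAr enormZ gtr0_norm// mulrC ler_wpM2r//; first exact: ltW.
apply: ub_le_sup; last by exists u => //=; rewrite u1.
exists `|c| => _ [y /= y1 <-]; apply: le_trans (Mc y) _.
rewrite (le_trans (ler_norm _))// normrM (ger0_norm (enorm_ge0 y)).
by rewrite ler_piMr.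
Qed.

Lemma enorm_mulmxB_O2 Q P x : O2 Q -> O2 P ->
  enorm ((Q - P) *m x) <= opnorm (Q - P) * enorm x.
Proof.
move=> QO PO; apply: (@le_opnorm _ 2) => y.
by rewrite mulmxBl (le_trans (enormD _ _))// enormN !enorm_O2// mulr_natl mulr2n.
Qed.

(** * Diameter *)

Definition dists A : set R := [set enorm (xy.1 - xy.2) | xy in A `*` A].

Lemma dist_le_diam A x y : has_ubound (dists A) -> A x -> A y ->
  enorm (x - y) <= diam A.
Proof. by move=> Ab Ax Ay; apply: ub_le_sup => //; exists (x, y). Qed.

Lemma diam_le A (d : R) x : A x ->
  (forall x y, A x -> A y -> enorm (x - y) <= d) -> diam A <= d.
Proof.
move=> Ax Ad; apply: ge_sup; first by exists (enorm (x - x)), (x, x).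
by move=> _ [[u v] [Au Av] <-]; exact: Ad.
Qed.

Lemma diam_ge0 A : 0 <= diam A.
Proof. by apply: sup_ge0 => _ [? _ <-]; exact: enorm_ge0. Qed.

Lemma diamS A B x : has_ubound (dists B) -> A x -> A `<=` B -> diam A <= diam B.
Proof.
by move=> Bb Ax AB; apply: (diam_le Ax) => u v Au Av; apply: dist_le_diam => //; exact: AB.
Qed.

Lemma enorm_continuous : continuous (@enorm R).
Proof.
have -> : @enorm R = fun x => Num.sqrt (x 0 0 ^+ 2 + x 1 0 ^+ 2).
  by apply/funext => x; rewrite enormE.
have sqr_continuous i : continuous (fun x : 'cV[R]_2 => x i 0 ^+ 2 : R^o).
  move=> x; apply: (continuous_comp (f := fun x => x i 0) (g := fun r => r ^+ 2)).
    exact: coord_continuous.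
  exact: exprn_continuous.
move=> x; apply: (continuous_comp (g := @Num.sqrt R)
  (f := fun x => x 0 0 ^+ 2 + x 1 0 ^+ 2 : R)); last exact: sqrt_continuous.
by apply: (@continuousD _ R^o); exact: sqr_continuous.
Qed.

Lemma compact_has_ubound_dists A : compact A -> has_ubound (dists A).
Proof.
move=> Ac; have [->|/set0P A0] := eqVneq A set0.
  by exists 0 => _ [[u v] [[]]].
have [c _ cmax] := compact_EVT_max A0 Ac (continuous_subspaceT enorm_continuous).
exists (enorm c + enorm c) => _ [[u v] /= [Au Av] <-].
by rewrite (le_trans (enormD _ _))// enormN lerD// cmax// inE.
Qed.

(** * Linear images *)

Lemma mulmx_continuous Q : continuous (fun z : 'cV[R]_2 => Q *m z).
Proof.
have -> : (fun z : 'cV[R]_2 => Q *m z) = fun z => z 0 0 *: col 0 Q + z 1 0 *: col 1 Q.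
  apply/funext => z; apply/matrixP => i j; rewrite (ord1 j) !mxE big_ord_recl big_ord1.
  by rewrite ![_ * Q _ _]mulrC; congr (_ + Q _ _ * z _ _); apply/val_inj.
move=> z; apply: (@continuousD _ _ _ (fun z => z 0 0 *: col 0 Q) (fun z => z 1 0 *: col 1 Q) z);
  by apply: continuousZr_tmp; exact: coord_continuous.
Qed.

Lemma affine_continuous a Q : continuous (fun z : 'cV[R]_2 => a + Q *m z).
Proof.
move=> z; apply: (@continuousD _ 'cV[R]_2); first exact: cst_continuous.
exact: mulmx_continuous.
Qed.

(** * The diameter of a tour *)

Lemma segment_within x y z c (r : R) : enorm (x - c) <= r -> enorm (y - c) <= r ->
  segment x y z -> enorm (z - c) <= r.
Proof.
move=> xr yr [t /=]; rewrite in_itv/= => /andP[t0 t1] <-.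
have -> : (1 - t) *: x + t *: y - c = (1 - t) *: (x - c) + t *: (y - c).
  by rewrite !scalerBr addrACA -opprD -scalerDl subrK scale1r.
rewrite (le_trans (enormD _ _))// !enormZ !ger0_norm ?subr_ge0//.
have -> : r = (1 - t) * r + t * r by ring.
by rewrite lerD// ler_wpM2l// subr_ge0.
Qed.

(** Balls are convex, so a polygonal line stays in every ball that contains its
    vertices. *)
Lemma polyline_within x (s : seq 'cV[R]_2) z c (r : R) :
  {in x :: s, forall y, enorm (y - c) <= r} -> polyline x s z -> enorm (z - c) <= r.
Proof.
elim: s x => [|y s IHs] x xsr /=; first by move=> ->; apply: xsr; rewrite mem_head.
case; last by apply: IHs => u us; apply: xsr; rewrite inE us orbT.
by apply: segment_within; apply: xsr; rewrite !inE eqxx ?orbT.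
Qed.

Lemma mem_polyline x (s : seq 'cV[R]_2) y : y \in x :: s -> polyline x s y.
Proof.
elim: s x => [|z s IHs] x /=; first by rewrite inE => /eqP.
rewrite inE => /predU1P[->|/IHs]; last by right.
by left; exists 0; rewrite /= ?in_itv/= ?lexx ?ler01// subr0 scale1r scale0r addr0.
Qed.

Section Vertices.
Import ArrowAsProduct.
Variable M : nat.
Implicit Types (p : 'I_M -> 'cV[R]_2) (pi : 'S_M).

(** The base point 0 of a tour is the vertex of index None. *)
Definition vertex p : option 'I_M -> 'cV[R]_2 := oapp p 0.

Definition vertices p : set 'cV[R]_2 := range (vertex p).

Lemma vertices0 p : vertices p 0. Proof. by exists None. Qed.

Lemma vertices_point p j : vertices p (p j). Proof. by exists (Some j). Qed.

Lemma vertices_bounded p : has_ubound (dists (vertices p)).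
Proof.
apply/compact_has_ubound_dists/finite_compact/finite_image; exact: finite_finset.
Qed.

Lemma tour_verticesP p pi y :
  y \in 0 :: rcons [seq p (pi k) | k <- enum 'I_M] 0 <-> vertices p y.
Proof.
rewrite inE mem_rcons inE orbA orbb; split.
  by case/predU1P => [->|/mapP[k _ ->]]; [exact: vertices0|exact: vertices_point].
case=> -[j _ <-|_ <-] /=; last by rewrite eqxx.
apply/orP; right; apply/mapP; exists ((pi^-1)%g j); last by rewrite permKV.
by rewrite mem_enum.
Qed.

(** The largest distance is attained at vertices: apply polyline_within once for
    each of the two points. *)
Lemma diam_tour p pi : diam (tour pi p) = diam (vertices p).
Proof.
have sub : vertices p `<=` tour pi p.
  by move=> y /(tour_verticesP p pi); exact: mem_polyline.
have dist_le x y : tour pi p x -> tour pi p y -> enorm (x - y) <= diam (vertices p).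
  move=> Tx Ty; apply: (polyline_within _ Tx) => u /tour_verticesP Vu.
  rewrite enormBC; apply: (polyline_within _ Ty) => v /tour_verticesP Vv.
  exact: dist_le_diam (vertices_bounded p) _ _.
apply/eqP; rewrite eq_le; apply/andP; split.
  by apply: (diam_le (x := 0)) => //; exact/sub/vertices0.
apply: (diamS (x := 0)) => //; last exact: vertices0.
by exists (diam (vertices p)) => _ [[x y] [Tx Ty] <-]; exact: dist_le.
Qed.

(** As a maximum of finitely many distances, the diameter depends continuously
    on the points. *)
Lemma diam_verticesE p : diam (vertices p) =
  \big[Num.max/0]_rs enorm (vertex p rs.1 - vertex p rs.2).
Proof.
apply/eqP; rewrite eq_le; apply/andP; split.
  apply: (diam_le (vertices0 p)) => _ _ [r _ <-] [s _ <-].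
  exact: (le_bigmax _ (fun rs => enorm (vertex p rs.1 - vertex p rs.2)) (r, s)).
apply/bigmax_leP; split=> [|[r s] _]; first exact: diam_ge0.
by apply: dist_le_diam; [exact: vertices_bounded|exists r|exists s].
Qed.

Lemma diam_vertices_continuous :
  continuous (fun p : prod_topology (fun _ : 'I_M => 'cV[R]_2) => diam (vertices p)).
Proof.
have -> : (fun p : 'I_M -> 'cV[R]_2 => diam (vertices p)) = fun p =>
  \big[Num.max/0]_rs enorm (vertex p rs.1 - vertex p rs.2).
  by apply/funext => p; exact: diam_verticesE.
have vertex_continuous r : continuous
    (fun p : prod_topology (fun _ : 'I_M => 'cV[R]_2) => vertex p r).
  by case: r => [j|] /=; [exact: proj_continuous|exact: cst_continuous].
apply: continuous_big => [|rs _ p]; first exact: max_continuous.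
apply: (continuous_comp (f := fun p => vertex p rs.1 - vertex p rs.2));
  last exact: enorm_continuous.
by apply: (@continuousB _ 'cV[R]_2); exact: vertex_continuous.
Qed.

End Vertices.

(** * Optimal choices of points *)

Lemma boundary_compact F : compact F -> compact (boundary F).
Proof.
move=> Fc; have Fcl : closed F by apply: compact_closed => //; exact: norm_hausdorff.
rewrite /boundary -(closure_id F).1// setDE.
by apply: compact_closedI => //; apply: open_closedC; exact: open_interior.
Qed.

Lemma neighborhood_compact F xi : compact F -> compact (neighborhood F xi).
Proof.
move=> /boundary_compact bFc.
have -> : neighborhood F xi =
    [set - (xi.2^T *m xi.1) + xi.2^T *m b | b in boundary F].
  by apply: eq_imagel => b _; rewrite mulmxBr addrC.
apply: continuous_compact => //; apply: continuous_subspaceT.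
exact: affine_continuous.
Qed.

Lemma minimum_unique (E : set R) (d : R) : E d -> lbound E d -> minimum E = d.
Proof.
move=> Ed lbd; apply: xget_unique => // e [Ee lbe].
by apply/eqP; rewrite eq_le lbe// lbd.
Qed.

Section Optimum.
Import ArrowAsProduct.

Definition meets_neighborhoods F (X : {fset config R}) (A : set 'cV[R]_2) : Prop :=
  forall xi, xi \in X -> (neighborhood F xi `&` A) !=set0.

Lemma sample_mem (X : {fset config R}) j : sample (X := X) j \in X.
Proof. exact: (mem_tnth j (in_tuple X)). Qed.

Lemma sample_surj (X : {fset config R}) xi :
  xi \in X -> exists j, sample (X := X) j = xi.
Proof. by move=> /(tnthP (in_tuple X))[j ->]; exists j. Qed.

(** The product of the compact neighborhoods is compact by Tychonoff's theorem,
    and the diameter of the vertices is continuous on it. *)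
Lemma sampled_diameterP F (X : {fset config R}) : compact F ->
  (forall xi, xi \in X -> neighborhood F xi !=set0) ->
  exists p : 'I_(size X) -> 'cV[R]_2,
  [/\ forall j, neighborhood F (sample j) (p j),
      sampled_diameter F X = diam (vertices p) &
      forall q : 'I_(size X) -> 'cV[R]_2, (forall j, neighborhood F (sample j) (q j)) ->
        diam (vertices p) <= diam (vertices q)].
Proof.
move=> Fcompact XN.
pose N := [set p : 'I_(size X) -> 'cV[R]_2 | forall j, neighborhood F (sample j) (p j)].
have N0 : N !=set0.
  have /choice[p pN] : forall j, exists z, neighborhood F (@sample R X j) z.
    by move=> j; have [z] := XN _ (sample_mem j); exists z.
  by exists p.
have Nc : @compact (prod_topology (fun _ : 'I_(size X) => 'cV[R]_2)) N.
  apply: (@tychonoff _ (fun=> 'cV[R]_2) (fun j => neighborhood F (sample j))) => j.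
  exact: neighborhood_compact.
have [p pN pmin] := compact_EVT_min N0 Nc (continuous_subspaceT (@diam_vertices_continuous _)).
rewrite inE in pN.
have {}pmin q : N q -> diam (vertices p) <= diam (vertices q).
  by move=> Nq; apply: pmin; rewrite inE.
exists p; split => //; apply: minimum_unique.
  by exists 1%g, p; split => //; rewrite diam_tour.
by move=> _ [pi [q [Nq ->]]]; rewrite diam_tour; exact: pmin.
Qed.

(** One point of A in each neighborhood gives a competitor in the minimization
    whose vertices, 0 included, all lie in A. *)
Lemma sampled_diameter_le F (X : {fset config R}) A : compact F ->
  has_ubound (dists A) -> A 0 -> meets_neighborhoods F X A ->
  sampled_diameter F X <= diam A.
Proof.
move=> Fcompact Ab A0 Ahit.
have [xi /Ahit[z [? _]]|p [_ -> pmin]] := @sampled_diameterP F X Fcompact; first by exists z.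
have /choice[q qNA] : forall j, exists z, (neighborhood F (@sample R X j) `&` A) z.
  by move=> j; have [z] := Ahit _ (sample_mem j); exists z.
apply: le_trans (pmin q (fun j => (qNA j).1)) _.
apply: diamS => //; first exact: vertices0.
by move=> _ [[j _ <-|_ <-]] //=; exact: (qNA j).2.
Qed.

End Optimum.

(** * From escape paths to choices of points *)

Lemma dists_translate A c : dists [set z - c | z in A] = dists A.
Proof.
have BK x y : x - c - (y - c) = x - y by rewrite opprB addrA subrK.
apply/seteqP; split=> [_ [[_ _] [[x Ax <-] [y Ay <-]] <-]|_ [[x y] [Ax Ay] <-]].
  by exists (x, y); rewrite //= BK.
exists (x - c, y - c); last by rewrite /= BK.
by split; [exists x|exists y].
Qed.

(** If the image avoided the boundary of F, the points of A sent into F and those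
    sent into its interior would be the same: a nonempty clopen part of A, hence
    all of A by connectedness. *)
Lemma boundary_hit F A a Q z0 : closed F -> connected A -> A z0 ->
  F (a + Q *m z0) -> ~ [set a + Q *m z | z in A] `<=` F° ->
  exists2 z, A z & boundary F (a + Q *m z).
Proof.
move=> Fcl Aconn Az0 Fz0 notint; apply: contrapT => nohit; apply: notint.
pose h z := a + Q *m z; have hc : continuous h := @affine_continuous a Q.
have AFint : A `&` h @^-1` F° = A `&` h @^-1` F.
  apply/seteqP; split => z [Az Fz]; split => //; first exact: interior_subset Fz.
  by apply: contrapT => nFz; apply: nohit; exists z => //; split => //; exact: subset_closure.
have AF : A `&` h @^-1` F = A.
  apply: Aconn; first by exists z0.
    exists (h @^-1` F°) => //; apply: open_comp => //; exact: open_interior.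
  by exists (h @^-1` F) => //; exact: (continuous_closedP h).1.
by move=> _ [z Az <-]; move: Az; rewrite -{1}AF -AFint => -[].
Qed.

(** For a sample (x, Q), move the trace by Q and then by x - Q g(0): its starting
    point is sent to x, a point of F, and boundary_hit applies. *)
Lemma escape_path_meets F (X : {fset config R}) g :
  compact F -> [set` X] `<=` configs F -> closed_path g -> diameter_escape F g ->
  meets_neighborhoods F X [set z - g 0 | z in trace g].
Proof.
move=> Fc XF [gc _] gesc [x Q] /XF[/= Fx QO].
have Fcl : closed F by apply: compact_closed => //; exact: norm_hausdorff.
have tr0 : trace g (g 0) by exists 0 => //=; rewrite in_itv/= lexx ler01.
have trconn : connected (trace g).
  by apply: connected_continuous_connected => //; exact: segment_connected.
have Fg0 : F (x - Q *m g 0 + Q *m g 0) by rewrite subrK.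
have [_ [t t01 <-] bd] := boundary_hit Fcl trconn tr0 Fg0 (gesc _ _ QO).
exists (g t - g 0); split; last by exists (g t) => //; exists t.
exists (x - Q *m g 0 + Q *m g t) => //=.
rewrite [X in _ *m X]addrAC [x - _ - x]addrAC subrr add0r addrC -mulmxBr.
by rewrite mulmxA QO mul1mx.
Qed.

(** A path running back and forth along a segment longer than the diameter of F
    escapes. *)
Lemma escape_path_exists F : compact F ->
  exists g, closed_path g /\ diameter_escape F g.
Proof.
move=> Fc; pose v : 'cV[R]_2 := delta_mx 0 0.
have v1 : enorm v = 1 by rewrite enormE !mxE/= expr1n expr0n addr0 sqrtr1.
(* t (1 - t) peaks at 1/4, so the segment has length diam F + 1. *)
pose d := 4 * (diam F + 1).
exists (fun t => (t * (1 - t) * d) *: v); split.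
  split; last by rewrite subrr mulr0 !mul0r.
  apply: continuous_subspaceT => t.
  apply: (@continuousZr_tmp R 'cV[R]_2 R (fun t => t * (1 - t) * d)).
  apply: (@continuousM R R (fun t => t * (1 - t)) (fun=> d)); last exact: cst_continuous.
  apply: (@continuousM R R id (fun t => 1 - t)); first exact: cvg_id.
  by apply: (@continuousB _ R^o _ (fun=> 1) id); [exact: cst_continuous|exact: cvg_id].
move=> a Q QO sub.
have Fin t : 0 <= t <= 1 -> F (a + Q *m ((t * (1 - t) * d) *: v)).
  move=> t01; apply: interior_subset; apply: sub; exists ((t * (1 - t) * d) *: v) => //.
  by exists t => //=; rewrite in_itv.
have := dist_le_diam (compact_has_ubound_dists Fc)
  (Fin 2^-1 ltac:(by lra)) (Fin 0 ltac:(by lra)).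
rewrite mul0r mul0r scale0r mulmx0 addr0 addrAC subrr add0r enorm_O2// enormZ v1 mulr1.
rewrite leNgt => /negP; apply; rewrite (lt_le_trans _ (ler_norm _))// /d; lra.
Qed.

Lemma neighborhood_nonempty F (X : {fset config R}) : compact F ->
  [set` X] `<=` configs F -> forall xi, xi \in X -> neighborhood F xi !=set0.
Proof.
move=> Fc XF xi Xxi; have [g [gpath gesc]] := escape_path_exists Fc.
by have [z []] := escape_path_meets Fc XF gpath gesc Xxi; exists z.
Qed.

Lemma sampled_le_critical F (X : {fset config R}) : compact F ->
  [set` X] `<=` configs F ->
  sampled_diameter F X <= critical_escape_diameter F.
Proof.
move=> Fc XF; apply: lb_le_inf.
  by have [g gP] := escape_path_exists Fc; exists (diam (trace g)), g.
move=> _ [g [gpath gesc] <-].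
have trc : compact (trace g).
  by apply: continuous_compact; [exact: gpath.1|exact: segment_compact].
have distsE := dists_translate (trace g) (g 0).
have -> : diam (trace g) = diam [set z - g 0 | z in trace g].
  by rewrite -[LHS]/(sup (dists _)) -distsE.
apply: sampled_diameter_le => //; last exact: escape_path_meets.
  by rewrite distsE; exact: compact_has_ubound_dists.
by exists (g 0); rewrite ?subrr//; exists 0; rewrite //= in_itv/= lexx ler01.
Qed.

(** * Convex sets, segments and circles *)

Lemma convex_segment F u v : convex_set F -> F u -> F v -> segment u v `<=` F.
Proof.
move=> Fconv Fu Fv z [t /=]; rewrite in_itv/= => /andP[t0 t1] <-{z}.
have := Fconv v u (Itv01 t0 t1); rewrite !inE addrC; exact.
Qed.

(** Translating both endpoints by the same small vector keeps them in F, and moves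
    the point of the segment by that vector. *)
Lemma interior_segment F u v : convex_set F -> F° u -> F° v -> segment u v `<=` F°.
Proof.
move=> Fconv Fu Fv z0 [t t01 z0E].
have shift u' : F° u' -> \forall z \near z0, F (u' + (z - z0)).
  move=> Fu'; have cont : {for z0, continuous (fun z => u' + (z - z0))}.
    apply: (@continuousD _ 'cV[R]_2); first exact: cst_continuous.
    by apply: (@continuousB _ 'cV[R]_2); [exact: cvg_id|exact: cst_continuous].
  by apply: cont; rewrite /= subrr addr0.
rewrite /interior/=; near=> z.
apply: (@convex_segment F (u + (z - z0)) (v + (z - z0))) => //.
- by near: z; exact: shift.
- by near: z; exact: shift.
exists t => //.
by rewrite scalerDr [t *: _]scalerDr addrACA z0E -scalerDl subrK scale1r addrC subrK.
Unshelve. all: by end_near. Qed.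

Definition circle (t : R) : 'cV[R]_2 := cos t *: delta_mx 0 0 + sin t *: delta_mx 1 0.

Lemma circle_x t : circle t 0 0 = cos t.
Proof. by rewrite !mxE/= mulr1 mulr0 addr0. Qed.

Lemma circle_y t : circle t 1 0 = sin t.
Proof. by rewrite !mxE/= mulr1 mulr0 add0r. Qed.

Lemma enorm_circle t : enorm (circle t) = 1.
Proof. by rewrite enormE circle_x circle_y cos2Dsin2 sqrtr1. Qed.

Lemma circle_continuous : continuous circle.
Proof.
move=> t; apply: (@continuousD R 'cV[R]_2 R (fun t => cos t *: delta_mx 0 0)
  (fun t => sin t *: delta_mx 1 0)).
  by apply: (@continuousZr_tmp R 'cV[R]_2 R); exact: continuous_cos.
by apply: (@continuousZr_tmp R 'cV[R]_2 R); exact: continuous_sin.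
Qed.

(** The vertical chord through w works: its endpoints have abscissa
    cos t = w_x and opposite ordinates. *)
Lemma unit_ball_chord w : enorm w <= 1 ->
  exists2 t, `|t| <= pi & segment (circle t) (circle (- t)) w.
Proof.
move=> w1; have ww : w 0 0 ^+ 2 + w 1 0 ^+ 2 <= 1 by rewrite -enorm_sqr expr_le1// enorm_ge0.
have x1 : -1 <= w 0 0 <= 1 by nra.
have [/andP[t0 tpi] cost] := acos_def x1; set t := acos _ in t0 tpi cost.
exists t; first by rewrite ger0_norm.
have s0 : 0 <= sin t by apply: sin_ge0_pi; rewrite t0.
have := cos2Dsin2 t; rewrite cost => cs.
have [st0|st0] := eqVneq (sin t) 0.
  exists 0; first by rewrite /= in_itv/= lexx ler01.
  rewrite subr0 scale1r scale0r addr0; apply: cV2_ext; rewrite ?circle_x ?circle_y//.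
  by rewrite st0 in cs *; nra.
have {}s0 : 0 < sin t by rewrite lt_neqAle eq_sym st0.
(* The parameter solving (1 - s) sin t - s sin t = w_y. *)
exists ((1 - w 1 0 / sin t) / 2).
  have : -1 <= w 1 0 / sin t <= 1.
    by rewrite ler_pdivlMr// ler_pdivrMr//; nra.
  by rewrite /= in_itv/=; lra.
apply: cV2_ext; rewrite !mxE/= cosN sinN cost; first by field.
by field.
Qed.

Lemma convex_ball_of_circle (C : set 'cV[R]_2) c (r : R) w :
  (forall u v, C u -> C v -> segment u v `<=` C) ->
  (forall t, `|t| <= pi -> C (c + r *: circle t)) -> enorm w <= r -> C (c + w).
Proof.
move=> Cconv Ccirc wr; have := le_trans (enorm_ge0 w) wr.
rewrite le0r => /predU1P[r0|r0].
  have -> : w = r *: circle 0.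
    rewrite r0 scale0r; apply: enorm_eq0; apply/eqP.
    by rewrite eq_le enorm_ge0 andbT -r0.
  by apply: Ccirc; rewrite normr0 pi_ge0.
have [|t tpi [s s01 sE]] := @unit_ball_chord (r^-1 *: w).
  by rewrite enormZ gtr0_norm ?invr_gt0// ler_pdivrMl// mulr1.
apply: (Cconv (c + r *: circle t) (c + r *: circle (- t))).
- exact: Ccirc.
- by apply: Ccirc; rewrite normrN.
exists s => //.
rewrite scalerDr [s *: (c + _)]scalerDr addrACA -scalerDl subrK scale1r; congr (_ + _).
by rewrite !scalerA ![_ * r]mulrC -!scalerA -scalerDr sE scalerA divff ?gt_eqF// scale1r.
Qed.

(** * From choices of points to closed paths *)

(** A cutoff with plateau [-4, 4], long enough for a full turn since pi < 4. *)
Definition plateau (t : R) : R := Num.max 0 (Num.min 1 (5 - `|t|)).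

Lemma plateau_itv t : 0 <= plateau t <= 1.
Proof. by rewrite /plateau le_max lexx ge_max ler01 ge_min lexx. Qed.

Lemma plateau_eq1 t : `|t| <= pi -> plateau t = 1.
Proof.
move=> tpi; have := @pihalf_02 R => /andP[_ pi4].
by rewrite /plateau min_l ?max_r//; lra.
Qed.

Lemma plateau_eq0 t : 5 <= `|t| -> plateau t = 0.
Proof. by move=> t5; rewrite /plateau max_l// ge_min; apply/orP; right; lra. Qed.

Lemma plateau_continuous : continuous plateau.
Proof.
move=> t; apply: (@continuous_max R R (fun=> 0) (fun t => Num.min 1 (5 - `|t|))).
  exact: cst_continuous.
apply: (@continuous_min R R (fun=> 1) (fun t => 5 - `|t|)); first exact: cst_continuous.
apply: (@continuousB R R^o R (fun=> 5) (fun t => `|t|)); first exact: cst_continuous.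
exact: norm_continuous.
Qed.

(** A curve based at 0 that goes around the circle of radius r about x for
    |t| <= pi and rests at 0 for |t| >= 5. *)
Definition loop (r : R) x (t : R) : 'cV[R]_2 := plateau t *: (x + r *: circle t).

Lemma loop_continuous r x : continuous (loop r x).
Proof.
move=> t; apply: (@continuousZ R 'cV[R]_2 R plateau (fun t => x + r *: circle t)).
  exact: plateau_continuous.
apply: (@continuousD R 'cV[R]_2 R (fun=> x) (fun t => r *: circle t)).
  exact: cst_continuous.
apply: (@continuousZl_tmp R 'cV[R]_2 R circle r); exact: circle_continuous.
Qed.

Section Bouquet.
Variables (M : nat) (r : R) (p : 'I_M -> 'cV[R]_2).

(** An affine clock, assigning to the loop j the subinterval
    [j / M, (j + 1) / M] of [0, 1], on which it runs from -5 to 5. *)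
Definition loop_time (j : 'I_M) (t : R) : R := 10 * M%:R * t - (10 * j%:R + 5).

(** At each time at most one term is nonzero, so the sum is the concatenation of
    the loops, and its continuity needs no gluing argument. *)
Definition bouquet (t : R) : 'cV[R]_2 := \sum_j loop r (p j) (loop_time j t).

Lemma loop_time_sep (i j : 'I_M) t : i != j -> `|loop_time j t| <= 5 ->
  5 <= `|loop_time i t|.
Proof.
rewrite /loop_time neq_ltn => ij; rewrite ler_norml => /andP[h1 h2]; rewrite ler_normr.
have lt_natS (k l : nat) : (k < l)%N -> k%:R + 1 <= l%:R :> R.
  by move=> kl; rewrite natr1 ler_nat.
by case/orP: ij => /lt_natS ij; apply/orP; [left|right]; lra.
Qed.

Lemma bouquet_loop j t : `|loop_time j t| <= 5 ->
  bouquet t = loop r (p j) (loop_time j t).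
Proof.
move=> jt; rewrite /bouquet (bigD1 j)//= big1 ?addr0// => i ij.
by rewrite /loop plateau_eq0 ?scale0r// (loop_time_sep ij).
Qed.

Lemma bouquet_continuous : continuous bouquet.
Proof.
apply: (@continuous_big 'cV[R]_2 'I_M +%R 0 xpredT _ R _
  (fun j t => loop r (p j) (loop_time j t))); first exact: add_continuous.
move=> j _ t; apply: (continuous_comp (f := loop_time j) (g := loop r (p j))).
  apply: (@continuousB R R^o R (fun t => 10 * M%:R * t) (fun=> 10 * j%:R + 5)).
    exact: mulrl_continuous.
  exact: cst_continuous.
exact: loop_continuous.
Qed.

Lemma bouquet_out t : (forall j, 5 <= `|loop_time j t|) -> bouquet t = 0.
Proof.
by move=> out; rewrite /bouquet big1// => j _; rewrite /loop plateau_eq0 ?scale0r.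
Qed.

Lemma bouquet0 : bouquet 0 = 0.
Proof.
apply: bouquet_out => j; rewrite /loop_time mulr0 add0r normrN ger0_norm.
  by rewrite lerDr mulr_ge0.
by rewrite addr_ge0// mulr_ge0.
Qed.

Lemma bouquet1 : bouquet 1 = 0.
Proof.
apply: bouquet_out => j; rewrite /loop_time mulr1 ler_normr; apply/orP; left.
have : j%:R + 1 <= M%:R :> R by rewrite natr1 ler_nat.
by lra.
Qed.

Lemma bouquet_closed_path : closed_path bouquet.
Proof.
by split; [exact/continuous_subspaceT/bouquet_continuous|rewrite bouquet0 bouquet1].
Qed.

Lemma bouquet_trace0 : trace bouquet 0.
Proof. by exists 0; rewrite ?bouquet0//= in_itv/= lexx ler01. Qed.

Lemma bouquet_circle j t : `|t| <= pi -> trace bouquet (p j + r *: circle t).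
Proof.
move=> tpi; have := @pihalf_02 R => /andP[_ pi4].
have M0 : 0 < 10 * M%:R :> R by rewrite mulr_gt0// ltr0n (leq_ltn_trans _ (ltn_ord j)).
have jM : j%:R + 1 <= M%:R :> R by rewrite natr1 ler_nat.
have j0 : 0 <= j%:R :> R by [].
pose s := (t + (10 * j%:R + 5)) / (10 * M%:R).
have sE : loop_time j s = t by rewrite /loop_time /s mulrC divfK ?gt_eqF// addrK.
have t4 : `|t| <= 4 by lra.
exists s; last by rewrite (bouquet_loop (j := j)) sE; [rewrite /loop plateau_eq1// scale1r|lra].
move: t4; rewrite ler_norml => /andP[t4 t4'].
by rewrite /= in_itv/= /s divr_ge0 ?ler_pdivrMr ?mul1r ?ltW//; lra.
Qed.

Lemma bouquet_near_star z : 0 <= r -> trace bouquet z ->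
  exists u w, [/\ z = u + w, exists2 v, vertices p v & segment 0 v u & enorm w <= r].
Proof.
move=> r0 [t _ <-].
have [[j jt]|out] := pselect (exists j, `|loop_time j t| <= 5); last first.
  exists 0, 0; split; rewrite ?addr0 ?enorm0//.
    by apply: bouquet_out => j; rewrite leNgt; apply/negP => /ltW jt; apply: out; exists j.
  exists 0; first exact: vertices0.
  by exists 0; rewrite ?scaler0 ?addr0//= in_itv/= lexx ler01.
rewrite (bouquet_loop jt) /loop; move: (loop_time j t) => s.
have /andP[s0 s1] := plateau_itv s.
exists (plateau s *: p j), ((plateau s * r) *: circle s); split.
- by rewrite scalerDr scalerA.
- exists (p j); first exact: vertices_point.
  by exists (plateau s); rewrite ?scaler0 ?add0r//= in_itv/= s0.
by rewrite enormZ enorm_circle mulr1 ger0_norm ?mulr_ge0// ler_piMl.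
Qed.

(** Up to errors of at most r, two points of the trace lie on segments from 0 to
    vertices, which are no further apart than the vertices themselves. *)
Lemma diam_bouquet : 0 <= r -> diam (trace bouquet) <= diam (vertices p) + 2 * r.
Proof.
move=> r0; apply: (diam_le bouquet_trace0) => z z'.
move=> /(bouquet_near_star r0)[u [w [-> [v Vv vu] wr]]].
move=> /(bouquet_near_star r0)[u' [w' [-> [v' Vv' vu'] wr']]].
have distV x y : vertices p x -> vertices p y -> enorm (x - y) <= diam (vertices p).
  by apply: dist_le_diam; exact: vertices_bounded.
have uV y : vertices p y -> enorm (u - y) <= diam (vertices p).
  by move=> Vy; apply: segment_within vu; apply: distV => //; exact: vertices0.
have uu' : enorm (u - u') <= diam (vertices p).
  by rewrite enormBC; apply: segment_within vu'; rewrite enormBC; apply: uV => //; exact: vertices0.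
rewrite opprD addrACA (le_trans (enormD _ _))// lerD//.
by rewrite (le_trans (enormD _ _))// enormN mulr_natl mulr2n lerD.
Qed.

End Bouquet.

(** * The escape property and the upper bound *)

Lemma net_radius_ge0 F (X : {fset config R}) (r : R) :
  F !=set0 -> is_net F r X -> 0 <= r.
Proof.
move=> [x Fx] [_ Xnet].
have [|zeta _] := Xnet (x, 1%:M); first by split => //; rewrite /O2/= trmx1 mulmx1.
by apply: le_trans; rewrite addr_ge0 ?enorm_ge0 ?mulr_ge0 ?diam_ge0 ?opnorm_ge0.
Qed.

(** Let (x, P) be the sample close to (a, Q) and b = x + P p_j the associated
    boundary point. With w := Q^T (b - a) - p_j one has a + Q (p_j + w) = b, and
    |w| = |x - a + (P - Q) p_j| <= |a - x| + |Q - P| diam F <= r because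
    |p_j| = |b - x| <= diam F. So b lies in a disc contained in the interior. *)
Lemma bouquet_escape F (X : {fset config R}) (r : R) (p : 'I_(size X) -> 'cV[R]_2) :
  compact F -> convex_set F -> is_net F r X ->
  (forall j, neighborhood F (sample j) (p j)) ->
  diameter_escape F (bouquet r p).
Proof.
move=> Fc Fconv [XF Xnet] pN a Q QO sub.
have Fcl : closed F by apply: compact_closed => //; exact: norm_hausdorff.
have Fa : F a.
  apply: interior_subset; apply: sub; exists 0; first exact: bouquet_trace0.
  by rewrite mulmx0 addr0.
have [xi /[dup] /XF [Fx PO] /sample_surj[j jxi] dxi] := Xnet (a, Q) (conj Fa QO).
have [b bdb pE] := pN j; rewrite jxi in pE.
case: xi => x P in Fx PO jxi dxi pE *.
rewrite /config_dist/= in Fx PO dxi pE.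
have Fb : F b by rewrite (closure_id F).1//; exact: bdb.1.
pose w := Q^T *m (b - a) - p j.
have Qw : Q *m w = x - a + (P - Q) *m p j.
  rewrite mulmxBr mulmxA O2_mulmxV// mul1mx mulmxBl -{2}pE mulmxA O2_mulmxV// mul1mx.
  by rewrite addrA; congr (_ - _); rewrite [RHS]addrC addrA subrK.
have wr : enorm w <= r.
  rewrite -(enorm_O2 _ QO) Qw (le_trans (enormD _ _))// (le_trans _ dxi)//.
  rewrite enormBC lerD2l -enormN -mulNmx opprB.
  rewrite (le_trans (enorm_mulmxB_O2 _ QO PO))// mulrC ler_wpM2r ?opnorm_ge0//.
  rewrite -pE enorm_O2; last exact: O2_tr.
  exact: dist_le_diam (compact_has_ubound_dists Fc) _ _.
have : F° (a + Q *m (p j + w)).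
  apply: (convex_ball_of_circle (C := [set z | F° (a + Q *m z)]) _ _ wr).
    move=> u v Fu Fv _ [t t01 <-]; apply: (interior_segment Fconv Fu Fv).
    exists t => //; rewrite scalerDr [t *: (a + _)]scalerDr addrACA -scalerDl subrK scale1r.
    by rewrite mulmxDr -!scalemxAr.
  by move=> t tpi; apply: sub; exists (p j + r *: circle t) => //; exact: bouquet_circle.
rewrite /w [p j + _]addrC subrK mulmxA O2_mulmxV// mul1mx addrC subrK.
by case: bdb.
Qed.

Lemma critical_le_sampled F (X : {fset config R}) (r : R) :
  compact F -> convex_set F -> F !=set0 -> is_net F r X ->
  critical_escape_diameter F <= sampled_diameter F X + 2 * r.
Proof.
move=> Fc Fconv F0 Xnet.
have r0 := net_radius_ge0 F0 Xnet.
have [p [pN -> _]] := sampled_diameterP Fc (neighborhood_nonempty Fc Xnet.1).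
apply: le_trans (diam_bouquet p r0); apply: ge_inf.
  by exists 0 => _ [h _ <-]; exact: diam_ge0.
exists (bouquet r p) => //; split; first exact: bouquet_closed_path.
exact: bouquet_escape.
Qed.

Lemma sampled_diameter_mono F (X Y : {fset config R}) : compact F ->
  [set` Y] `<=` configs F -> (X `<=` Y)%fset ->
  sampled_diameter F X <= sampled_diameter F Y.
Proof.
move=> Fc YF /fsubsetP XY.
have [p [pN -> _]] := sampled_diameterP Fc (neighborhood_nonempty Fc YF).
apply: sampled_diameter_le => //; [exact: vertices_bounded|exact: vertices0|].
move=> xi /XY /sample_surj[j <-].
by exists (p j); split => //; exact: vertices_point.
Qed.

End Plane.

Theorem theorem7 (R : realType) (F : set 'cV[R]_2)
    (Fcompact : compact F) (Fconvex : convex_set F) (Finterior : F° !=set0)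
    (X : nat -> {fset config R}) (eta : nat -> R)
    (Xnet : forall m, is_net F (eta m) (X m)) :
  (forall m, sampled_diameter F (X m) <= critical_escape_diameter F
             <= sampled_diameter F (X m) + 2 * eta m) /\
  (eta @ \oo --> (0 : R) ->
     (fun m => sampled_diameter F (X m)) @ \oo --> critical_escape_diameter F) /\
  ((forall m, X m `<=` X m.+1)%fset ->
     nondecreasing_seq (fun m => sampled_diameter F (X m))).
Proof.
have F0 : F !=set0 by have [x /interior_subset Fx] := Finterior; exists x.
have bounds m : sampled_diameter F (X m) <= critical_escape_diameter F
    <= sampled_diameter F (X m) + 2 * eta m.
  rewrite sampled_le_critical ?critical_le_sampled//; exact: (Xnet m).1.
split=> //; split=> [eta0|nested].
  apply: (@squeeze_cvgr _ _ _ _ (fun m => critical_escape_diameter F - 2 * eta m)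
                           (fun=> critical_escape_diameter F)).
  - by near=> m; rewrite lerBlDr; have /andP[-> ->] := bounds m.
  - rewrite -[X in _ --> X]subr0 -[X in _ - X](mulr0 2).
    by apply: cvgB; [exact: cvg_cst|exact: cvgMr].
  - exact: cvg_cst.
apply/nondecreasing_seqP => m.
by apply: sampled_diameter_mono => //; exact: (Xnet m.+1).1.
Unshelve. all: by end_near. Qed.
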